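(* If in some coordinate system $(\xi^j,\tau)$ the Minkowski spacetime invariant interval is $$ds^2=d\vec\xi^2-\left[1+\vec\xi\cdot\vec a(\tau)\right]^2d\tau^2$$ for some three functions $a_i(\tau)$, $i=1,2,3$, then $(\xi^j,\tau)$ are the Fermi-Walker coordinates based on some origin worldline.
   Context: Minkowski spacetime is $\mathbb{R}^4$ with Lorentzian coordinates $x^\mu$, $\mu=1,\dots,4$, and metric $\eta_{\mu\nu}=\mathrm{diag}(1,1,1,-1)$ (units $c=1$); indices are raised and lowered with $\eta$. $\vec\xi=(\xi^1,\xi^2,\xi^3)$ and $\vec\xi\cdot\vec a=\sum_{i=1}^3\xi^ia_i$. The coordinates are restricted to the region $1+\vec\xi\cdot\vec a(\tau)>0$. Let $z^\mu(\tau)$ be a timelike worldline parametrized by proper time (the origin worldline), with unit velocity $u^\mu=\dot z^\mu$ and proper acceleration $a^\mu=\ddot z^\mu$. A 4-vector $w^\mu(\tau)$ is Fermi-Walker transported along $z^\mu(\tau)$ if $\frac{dw^\mu}{d\tau}=(u^\mu a_\nu-u_\nu a^\mu)w^\nu$. Let $e^\mu_{(\alpha)}(\tau)$, $\alpha=1,\dots,4$, be an orthonormal tetrad that is Fermi-Walker transported along $z^\mu(\tau)$ and such that $e^\mu_{(4)}=u^\mu$. The Fermi-Walker coordinates $(\xi^i,\tau)$ based on the origin worldline $z^\mu(\tau)$ of a point with Lorentzian coordinates $x^\mu$ are defined by $[x^\mu-z^\mu(\tau)]\,u_\mu(\tau)=0$, which gives $\tau$ as an implicit function of $x$, and $\xi^i=[x_\mu-z_\mu(\tau)]\,e^\mu_{(i)}(\tau)$,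 $i=1,2,3$; that is, $x^\mu=z^\mu(\tau)+\sum_{i=1}^3\xi^i\,e^\mu_{(i)}(\tau)$. *)

(* Defs.v *)
From HB Require Import structures.
From mathcomp Require Import all_boot all_order all_algebra.
From mathcomp Require Import all_classical all_reals all_analysis.

Set Implicit Arguments.
Unset Strict Implicit.
Unset Printing Implicit Defensive.

Import Order.TTheory GRing.Theory Num.Theory.
Import numFieldNormedType.Exports.

Local Open Scope classical_set_scope.
Local Open Scope ring_scope.

(* The Lorentzian coordinates x^1, ..., x^4 are numbered from 0 in 'I_4, so
   that ord_max is the time index and lift ord_max : 'I_3 -> 'I_4 is the
   inclusion of the spatial indices.  A point (xi, tau) of the other coordinate
   system is an element of 'rV[R]_3 * R^o. *)

Definition eta (R : realType) : 'M[R]_4 :=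
  diag_mx (\row_(m < 4) (if m == ord_max then -1 else 1)).

Definition mink (R : realType) (v w : 'rV[R]_4) : R :=
  (v *m eta R *m w^T) 0 0.

Definition dot3 (R : realType) (v w : 'rV[R]_3) : R := \sum_(i < 3) v 0 i * w 0 i.

(* Class C^k on a set D, meant for open D.  In finite dimension, continuity of
   all the directional derivatives of a differentiable function is the same as
   continuity of its differential. *)
Fixpoint Ck (R : realType) (V W : normedModType R) (k : nat) (D : set V)
    (f : V -> W) : Prop :=
  match k with
  | 0 => forall p, D p -> {for p, continuous f}
  | k'.+1 => (forall p, D p -> differentiable f p) /\
             forall v : V, Ck k' D (fun p => 'D_v f p)
  end.

(* X expresses the Lorentzian coordinates through (xi, tau) and D is the range
   of the new coordinates.  By the inverse function theorem these conditions
   say that X is a C^2 diffeomorphism from D onto an open set of spacetime. *)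
Record coordinate_system (R : realType) (D : set ('rV[R]_3 * R^o))
    (X : 'rV[R]_3 * R^o -> 'rV[R]_4) : Prop := {
  coord_open : open D;
  coord_connected : connected D;
  coord_nonempty : D !=set0;
  coord_C2 : Ck 2 D X;
  coord_inj : set_inj D X;
  coord_jacobian : forall p, D p -> bijective ('d X p)
}.

(* ds^2 = d xi^2 - (1 + xi . a(tau))^2 d tau^2: the pullback of eta by X is
   evaluated, as a quadratic form, on the tangent vector (dxi, dtau). *)
Definition interval_form (R : realType) (D : set ('rV[R]_3 * R^o))
    (X : 'rV[R]_3 * R^o -> 'rV[R]_4) (a : R -> 'rV[R]_3) : Prop :=
  forall p, D p -> forall (dxi : 'rV[R]_3) (dtau : R^o),
    mink ('d X p (dxi, dtau)) ('d X p (dxi, dtau)) =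
    dot3 dxi dxi - (1 + dot3 p.1 (a p.2)) ^+ 2 * dtau ^+ 2.

Definition velocity (R : realType) (z : R^o -> 'rV[R]_4) : R^o -> 'rV[R]_4 :=
  derive1 z.
Definition acceleration (R : realType) (z : R^o -> 'rV[R]_4) : R^o -> 'rV[R]_4 :=
  derive1 (velocity z).

(* No time orientation is imposed: replacing tau by - tau preserves the form of
   the interval. *)
Definition worldline (R : realType) (I : set R^o) (z : R^o -> 'rV[R]_4) : Prop :=
  Ck 2 I z /\ forall tau, I tau -> mink (velocity z tau) (velocity z tau) = -1.

Definition Fermi_Walker_transported (R : realType) (I : set R^o) (z : R^o -> 'rV[R]_4)
    (w : R^o -> 'rV[R]_4) : Prop :=
  forall tau, I tau ->
    is_derive tau 1 w (mink (acceleration z tau) (w tau) *: velocity z tau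
                       - mink (velocity z tau) (w tau) *: acceleration z tau).

Definition orthonormal_tetrad (R : realType) (I : set R^o)
    (e : 'I_4 -> R^o -> 'rV[R]_4) : Prop :=
  forall tau, I tau -> forall al be, mink (e al tau) (e be tau) = eta R al be.

Definition Fermi_Walker_tetrad (R : realType) (I : set R^o) (z : R^o -> 'rV[R]_4)
    (e : 'I_4 -> R^o -> 'rV[R]_4) : Prop :=
  [/\ orthonormal_tetrad I e,
      forall al, Fermi_Walker_transported I z (e al) &
      forall tau, I tau -> e ord_max tau = velocity z tau].

(* Components a_i = a_mu e^mu_(i) of the proper acceleration. *)
Definition acceleration_components (R : realType) (z : R^o -> 'rV[R]_4)
    (e : 'I_4 -> R^o -> 'rV[R]_4) (tau : R^o) : 'rV[R]_3 :=
  \row_(i < 3) mink (acceleration z tau) (e (lift ord_max i) tau).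

Definition Fermi_Walker_coordinates (R : realType) (D : set ('rV[R]_3 * R^o))
    (X : 'rV[R]_3 * R^o -> 'rV[R]_4) (z : R^o -> 'rV[R]_4) : Prop :=
  exists e, Fermi_Walker_tetrad (snd @` D) z e /\
    forall (xi : 'rV[R]_3) (tau : R^o), D (xi, tau) ->
      [/\ 0 < 1 + dot3 xi (acceleration_components z e tau),
          mink (X (xi, tau) - z tau) (velocity z tau) = 0 &
          forall i : 'I_3,
            xi 0 i = mink (X (xi, tau) - z tau) (e (lift ord_max i) tau)].

(* Main.v *)
(** Let N = 1 + xi . a, E_i = D_i X and U = N^-1 D_tau X: these four vectors form
    an orthonormal frame. The Koszul formula computes the products of the second
    derivatives of X with the frame: D_i D_j X = 0 and D_i D_tau X = a_i U. Hence
    E_i, U and Z = X - sum_i xi_i E_i do not vary with xi, and along tau they obey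
      E_i' = a_i U,  U' = sum_i a_i E_i,  Z' = U,
    so Z is the origin worldline and (E_i, U) its Fermi-Walker tetrad. The slices
    of D at constant tau may be disconnected, so independence of xi is a priori
    only local; it becomes global because a solution of this linear system is
    determined by its value at one time and D is connected. *)
Require Import Defs.
From mathcomp Require Import all_boot all_order all_algebra.
From mathcomp Require Import all_classical all_reals all_analysis.
From mathcomp Require Import ring lra.
Import numFieldNormedType.Exports.
Local Open Scope classical_set_scope.
Local Open Scope ring_scope.

Set Implicit Arguments.
Unset Strict Implicit.
Unset Printing Implicit Defensive.
Import Order.TTheory GRing.Theory Num.Theory.

(** * Differentiation *)

Section Derivatives.
Context {R : realType} {V : normedModType R}.
Implicit Types (p v : V).

Lemma is_derive_mxP {m n} (M : V -> 'M[R]_(m, n)) p v dM :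
  is_derive p v M dM <->
  forall i j, is_derive p v (fun q => M q i j) (dM i j).
Proof.
split=> [[dermM <-] i j|dermM].
  have /derivable_mxP dermMij := dermM.
  by rewrite derive_mx// mxE; exact: derivableP.
have derM : derivable M p v by apply/derivable_mxP => i j; exact: ex_derive.
split=> //; rewrite derive_mx//; apply/matrixP => i j.
by rewrite mxE; exact: derive_val.
Qed.

Lemma is_derive_mul (f g : V -> R) p v df dg :
  is_derive p v f df -> is_derive p v g dg ->
  is_derive p v (fun q => f q * g q) (df * g p + f p * dg).
Proof.
move=> dfp dgp; apply: is_derive_eq (is_deriveM dfp dgp) _.
by rewrite /GRing.scale/= addrC [g p * _]mulrC.
Qed.

Lemma is_derive_trmx {m n} (M : V -> 'M[R]_(m, n)) p v dM :
  is_derive p v M dM -> is_derive p v (fun q => (M q)^T) dM^T.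
Proof.
move=> /is_derive_mxP dMp; apply/is_derive_mxP => i j; rewrite mxE.
by under eq_fun do rewrite mxE.
Qed.

Lemma is_derive_mulmx {m n k} (F : V -> 'M[R]_(m, n)) (G : V -> 'M[R]_(n, k))
    p v dF dG :
  is_derive p v F dF -> is_derive p v G dG ->
  is_derive p v (fun q => F q *m G q) (dF *m G p + F p *m dG).
Proof.
move=> /is_derive_mxP dFp /is_derive_mxP dGp; apply/is_derive_mxP => i j.
have -> : (fun q => (F q *m G q) i j) = \sum_l (fun q => F q i l * G q l j).
  by apply/funext => q; rewrite mxE fct_sumE.
rewrite !mxE -big_split/=; apply: is_derive_sum => l.
exact: is_derive_mul.
Qed.

Lemma is_derive_scale {m n} (f : V -> R) (F : V -> 'M[R]_(m, n)) p v df dF :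
  is_derive p v f df -> is_derive p v F dF ->
  is_derive p v (fun q => f q *: F q) (df *: F p + f p *: dF).
Proof.
move=> dfp /is_derive_mxP dFp; apply/is_derive_mxP => i j.
rewrite !mxE; under eq_fun do rewrite mxE.
exact: is_derive_mul.
Qed.

(** Both sides have the same difference quotient, so results on functions of one real variable apply
    along lines. *)
Lemma is_derive_lineP {W : normedModType R} (f : V -> W) p v (s : R) l :
  is_derive (s *: v + p) v f l <-> is_derive s 1 (fun h : R => f (h *: v + p)) l.
Proof.
have E : (fun h : R => h^-1 *: ((f \o shift (s *: v + p)) (h *: v)
            - f (s *: v + p))) =
    (fun h : R => h^-1 *: (((fun h : R => f (h *: v + p)) \o shift s) (h *: 1)
            - f (s *: v + p))).
  by apply/funext => h; rewrite /= [h%:A]mulr1 addrA scalerDl.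
by split=> -[fd <-]; split; move: fd; rewrite /derivable /derive E.
Qed.

End Derivatives.
Arguments is_derive_lineP {R V W} f p v s {l}.

(** Restriction to the line through [p] in direction [v] reduces this to the one-variable chain
    rule, so [f] only has to be derivable in that direction. *)
Lemma is_derive_comp1 {R : realType} {V : normedModType R}
    (f : V -> R) (g : R -> R) p v df dg :
  is_derive p v f df -> is_derive (f p) 1 g dg ->
  is_derive p v (fun q => g (f q)) (df * dg).
Proof.
move=> dfp dgp.
have dl : is_derive (0 : R) 1 (fun h : R => f (h *: v + p)) df.
  by apply/(is_derive_lineP f p v 0); rewrite scale0r add0r.
have dg0 : is_derive (f (0 *: v + p)) 1 g dg by rewrite scale0r add0r.
have := is_derive1_comp dg0 dl; rewrite mulrC.
by move=> /(is_derive_lineP (fun q => g (f q)) p v 0); rewrite scale0r add0r.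
Qed.

Lemma MVT_cc {R : realType} (f df : R -> R) (a b : R) : a <= b ->
  (forall x, a <= x <= b -> is_derive x 1 f (df x)) ->
  exists2 c, a <= c <= b & f b - f a = df c * (b - a).
Proof.
move=> ab fd; have [||c] := @MVT_segment _ f df a b ab.
- by move=> x; rewrite in_itv/= => /andP[ax xb]; apply: fd; rewrite !ltW.
- apply: derivable_within_continuous => x; rewrite in_itv/= => xab.
  by have [] := fd _ xab.
- by rewrite in_itv/= => cab ->; exists c.
Qed.

(** The mean value theorem concerns real-valued functions, so it is applied to each entry. *)
Lemma is_derive0_eq {R : realType} {m n} (M : R -> 'M[R]_(m, n)) (J : set R) :
  is_interval J -> (forall t, J t -> is_derive t 1 M 0) ->
  forall s t, J s -> J t -> M s = M t.
Proof.
move=> Ji dM; suff le s t : s <= t -> J s -> J t -> M s = M t.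
  by move=> s t Js Jt; have [/le->//|/ltW/le<-//] := leP s t.
move=> st Js Jt; apply/matrixP => i j.
have [|c _] := @MVT_cc _ (fun x => M x i j) (cst 0) s t st.
  move=> x xst; have /is_derive_mxP /(_ i j) := dM x (Ji _ _ Js Jt _ xst).
  by rewrite mxE.
by rewrite mul0r => /subr0_eq ->.
Qed.

(** * Symmetry of second derivatives of real functions *)

Section Schwarz.
Context {R : realType} {V : normedModType R}.

(** The mean value theorem is used twice: in direction [u] for the difference of [f] between two
    opposite edges of the parallelogram, then in direction [v] for ['D_u f]. *)
Lemma mixed_difference (f : V -> R) (p u v : V) (h : R) : 0 <= h ->
  (forall s t, 0 <= s <= h -> 0 <= t <= h ->
    derivable f (s *: u + (t *: v + p)) u /\
    derivable ('D_u f) (t *: v + (s *: u + p)) v) ->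
  exists s t, [/\ 0 <= s <= h, 0 <= t <= h &
    f (h *: u + (h *: v + p)) - f (h *: u + p) - f (h *: v + p) + f p =
    'D_v ('D_u f) (t *: v + (s *: u + p)) * h * h].
Proof.
move=> h0 fd.
have hh : 0 <= h <= h by rewrite h0 lexx.
have h00 : 0 <= (0 : R) <= h by rewrite h0 lexx.
pose g (s : R) := f (s *: u + (h *: v + p)) - f (s *: u + p).
have [s sh|c ch] := @MVT_cc _ g (fun s =>
    'D_u f (s *: u + (h *: v + p)) - 'D_u f (s *: u + p)) 0 h h0.
  have d1 : is_derive s 1 (fun s => f (s *: u + (h *: v + p)))
      ('D_u f (s *: u + (h *: v + p))).
    apply/(is_derive_lineP f (h *: v + p) u s)/derivableP.
    exact: (fd s h sh hh).1.
  have d2 : is_derive s 1 (fun s => f (s *: u + p)) ('D_u f (s *: u + p)).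
    apply/(is_derive_lineP f p u s)/derivableP.
    by have := (fd s 0 sh h00).1; rewrite scale0r add0r.
  exact: is_deriveB d1 d2.
rewrite /g subr0 !scale0r !add0r => E.
have [t th|d dh] := @MVT_cc _ (fun t => 'D_u f (t *: v + (c *: u + p)))
    (fun t => 'D_v ('D_u f) (t *: v + (c *: u + p))) 0 h h0.
  apply/(is_derive_lineP ('D_u f) (c *: u + p) v t)/derivableP.
  exact: (fd c t ch th).2.
rewrite subr0 scale0r add0r => E'.
exists c, d; split => //.
by rewrite -E' (addrCA (h *: v) (c *: u)) -E opprB [RHS]addrA [RHS]addrAC.
Qed.

Lemma near_parallelogram (p u v : V) (P : set V) : (\forall q \near p, P q) ->
  exists2 h : R, 0 < h & forall s t, 0 <= s <= h -> 0 <= t <= h ->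
    P (s *: u + (t *: v + p)).
Proof.
move=> /nbhs_ballP[e /= e0 eP].
have k0 : 0 < `|u| + `|v| + 1 by rewrite ltr_wpDl// addr_ge0.
(* The summand 1 keeps the denominator positive when [u] and [v] vanish, and makes the final bound
   strict. *)
exists (e / (`|u| + `|v| + 1)); first exact: divr_gt0.
move=> s t /andP[s0 sh] /andP[t0 th]; apply: eP.
rewrite -ball_normE/= addrA opprD addrCA subrr addr0 normrN.
apply: le_lt_trans (ler_normD _ _) _; rewrite !normrZ !ger0_norm//.
apply: (@le_lt_trans _ _ (e / (`|u| + `|v| + 1) * (`|u| + `|v|))).
  by rewrite mulrDr lerD// ler_wpM2r.
by rewrite mulrAC ltr_pdivrMr// ltr_pM2l// ltrDl.
Qed.

(** The second difference over a small parallelogram is symmetric in [u] and [v]. Evaluated in both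
    orders, it equates the two mixed derivatives at two points near [p]; continuity carries this to
    [p]. *)
Lemma derive_commute (D : set V) (f : V -> R) (p u v : V) : open D -> D p ->
  (forall q, D q -> derivable f q u /\ derivable f q v) ->
  (forall q, D q -> derivable ('D_u f) q v /\ derivable ('D_v f) q u) ->
  {for p, continuous ('D_u ('D_v f))} -> {for p, continuous ('D_v ('D_u f))} ->
  'D_u ('D_v f) p = 'D_v ('D_u f) p.
Proof.
move=> Do Dp fd fdd cuv cvu.
apply/eqP; rewrite -subr_eq0 -normr_le0; apply/ler_addgt0Pl => e e0; rewrite addr0.
have close (x y z : R) : `|x - z| < e / 2 -> `|y - z| < e / 2 -> `|x - y| <= e.
  move=> xz yz; rewrite -(subrKA z) [e]splitr (le_trans (ler_normD _ _))//.
  by rewrite lerD ?ltW// distrC.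
have e20 : 0 < e / 2 by rewrite divr_gt0.
have n0 : \forall q \near p, D q by apply: open_nbhs_nbhs.
have n1 : \forall q \near p, `|'D_u ('D_v f) p - 'D_u ('D_v f) q| < e / 2.
  exact: (cvgrPdist_lt _ _).1 cuv _ e20.
have n2 : \forall q \near p, `|'D_v ('D_u f) p - 'D_v ('D_u f) q| < e / 2.
  exact: (cvgrPdist_lt _ _).1 cvu _ e20.
have nD : \forall q \near p, [/\ D q,
    `|'D_u ('D_v f) p - 'D_u ('D_v f) q| < e / 2 &
    `|'D_v ('D_u f) p - 'D_v ('D_u f) q| < e / 2].
  by apply: filterS3 n0 n1 n2 => q; split.
have [h h0 hP] := near_parallelogram u v nD.
have [|s [t [sh th E]]] := @mixed_difference f p u v h (ltW h0).
  move=> s t sh th; have [Dq _ _] := hP _ _ sh th; split.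
    exact: (fd _ Dq).1.
  by rewrite addrCA; exact: (fdd _ Dq).1.
have [|t' [s' [th' sh' E']]] := @mixed_difference f p v u h (ltW h0).
  move=> t' s' th' sh'; have [Dq _ _] := hP _ _ sh' th'; split.
    by rewrite addrCA; exact: (fd _ Dq).2.
  exact: (fdd _ Dq).2.
have [_ _ lt1] := hP _ _ sh th; have [_ lt2 _] := hP _ _ sh' th'.
have EE : 'D_v ('D_u f) (t *: v + (s *: u + p)) =
          'D_u ('D_v f) (s' *: u + (t' *: v + p)).
  apply: (mulIf (lt0r_neq0 h0)); apply: (mulIf (lt0r_neq0 h0)).
  apply: etrans (esym E) _; apply: etrans _ E'.
  by rewrite (addrCA (h *: v)) [X in X + f p = _]addrAC.
rewrite addrCA EE in lt1.
exact: close lt2 lt1.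
Qed.

End Schwarz.

(** * Minkowski product and orthonormal frames *)

Section Minkowski.
Context {R : realType}.
Implicit Types (u v w : 'rV[R]_4) (F : 'M[R]_4) (b : 'rV[R]_3).

Lemma tr_eta : (eta R)^T = eta R.
Proof. exact: tr_diag_mx. Qed.

Lemma eta_mul : eta R *m eta R = 1%:M.
Proof.
rewrite mulmx_diag; apply/matrixP => i j; rewrite !mxE.
by case: ifP => _; rewrite ?mulrNN mulr1.
Qed.

Lemma minkC v w : mink v w = mink w v.
Proof.
rewrite /mink; have -> : v *m eta R *m w^T = (w *m eta R *m v^T)^T.
  by rewrite !trmx_mul trmxK tr_eta mulmxA.
by rewrite mxE.
Qed.

Lemma minkDl u v w : mink (u + v) w = mink u w + mink v w.
Proof. by rewrite /mink !mulmxDl mxE. Qed.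

Lemma minkZl k v w : mink (k *: v) w = k * mink v w.
Proof. by rewrite /mink -!scalemxAl mxE. Qed.

Lemma minkDr u v w : mink u (v + w) = mink u v + mink u w.
Proof. by rewrite minkC minkDl !(minkC u). Qed.

Lemma minkZr k v w : mink v (k *: w) = k * mink v w.
Proof. by rewrite minkC minkZl (minkC v). Qed.

Lemma mink0l w : mink 0 w = 0.
Proof. by rewrite -(scale0r 0) minkZl mul0r. Qed.

Lemma mink_suml n (f : 'I_n -> 'rV[R]_4) w :
  mink (\sum_(i < n) f i) w = \sum_(i < n) mink (f i) w.
Proof. by rewrite /mink !mulmx_suml summxE. Qed.

Lemma is_derive_mink {V : normedModType R} (f g : V -> 'rV[R]_4) (p h : V)
    df dg :
  is_derive p h f df -> is_derive p h g dg ->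
  is_derive p h (fun q => mink (f q) (g q)) (mink df (g p) + mink (f p) dg).
Proof.
move=> dfp dgp.
have deta : is_derive p h (cst (eta R)) 0 by exact: is_derive_cst.
have /is_derive_mxP/(_ 0 0) :=
  is_derive_mulmx (is_derive_mulmx dfp deta) (is_derive_trmx dgp).
by rewrite mulmx0 addr0 [X in is_derive _ _ _ X]mxE.
Qed.

(** The vectors are rows, the timelike one at the time index, so that changes of frame act by
    multiplication on the left. *)
Definition frame (E : 'I_3 -> 'rV[R]_4) u : 'M[R]_4 :=
  \matrix_al (if unlift ord_max al is Some j then E j else u).

Lemma row_frame_lift E u j : row (lift ord_max j) (frame E u) = E j.
Proof. by rewrite rowK liftK. Qed.

Lemma row_frame_max E u : row ord_max (frame E u) = u.
Proof. by rewrite rowK unlift_none. Qed.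

Lemma ord_max_liftP (P : 'I_4 -> Prop) :
  P ord_max -> (forall j, P (lift ord_max j)) -> forall al, P al.
Proof. by move=> Pm Pl al; case: (unliftP ord_max al) => [j|] ->. Qed.

Lemma mink_row v F al : mink v (row al F) = (v *m eta R *m F^T) 0 al.
Proof.
by rewrite /mink !mxE; apply: eq_bigr => k _; rewrite !mxE.
Qed.

Lemma mink_rows F al be :
  mink (row al F) (row be F) = (F *m eta R *m F^T) al be.
Proof. by rewrite mink_row -!row_mul mxE. Qed.

(** Equivalently, [F] is a Lorentz matrix; the left-hand side is the Gram matrix of its rows. *)
Definition orthonormal_frame F := F *m eta R *m F^T = eta R.

(** The product of [eta], [F^T] and [eta] is a right inverse of the square matrix [F], hence also a
    left inverse. *)
Lemma orthonormal_frame_tr F :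
  orthonormal_frame F -> F^T *m eta R *m F = eta R.
Proof.
move=> oF.
have : eta R *m F^T *m eta R *m F = 1%:M.
  by apply: mulmx1C; rewrite !mulmxA oF eta_mul.
by move=> /(congr1 (mulmx (eta R))); rewrite !mulmxA eta_mul mul1mx mulmx1.
Qed.

Lemma mink_frame_eq F v w : orthonormal_frame F ->
  (forall al, mink v (row al F) = mink w (row al F)) -> v = w.
Proof.
move=> /orthonormal_frame_tr oF vw.
have : v *m eta R *m F^T = w *m eta R *m F^T.
  by apply/rowP => al; rewrite -!mink_row.
move=> /(congr1 (fun x => x *m eta R *m F)).
by rewrite -!mulmxA [F^T *m (_ *m _)]mulmxA oF eta_mul !mulmx1.
Qed.

Lemma orthonormal_frameP E u :
  (forall i j, mink (E i) (E j) = (i == j)%:R) ->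
  (forall i, mink (E i) u = 0) -> mink u u = -1 ->
  orthonormal_frame (frame E u).
Proof.
move=> EE Eu uu; apply/matrixP => al be; rewrite -mink_rows !mxE.
elim/ord_max_liftP: al => [|i]; elim/ord_max_liftP: be => [|j].
- by rewrite row_frame_max uu eqxx.
- by rewrite row_frame_max row_frame_lift minkC Eu (negPf (neq_lift _ _)).
- by rewrite row_frame_max row_frame_lift Eu eq_sym (negPf (neq_lift _ _)).
- rewrite !row_frame_lift EE (inj_eq lift_inj).
  by rewrite [_ == ord_max]eq_sym (negPf (neq_lift _ _)).
Qed.

(* Boosts are the infinitesimal Lorentz transformations of Fermi-Walker
   transport, acting on the index of the frame. *)
Definition boost b : 'M[R]_4 := \matrix_(al, be)
  match unlift ord_max al, unlift ord_max be with
  | Some i, None | None, Some i => b 0 i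
  | _, _ => 0
  end.

(** A boost is symmetric and has only mixed space-time entries, on which the two signs of [eta]
    cancel. *)
Lemma boost_eta b : (boost b)^T *m eta R + eta R *m boost b = 0.
Proof.
apply/matrixP => al be; rewrite mul_mx_diag mul_diag_mx !mxE.
elim/ord_max_liftP: al => [|i]; elim/ord_max_liftP: be => [|j];
  rewrite ?liftK ?unlift_none ?eqxx ?mul0r ?mulr0 ?addr0//;
  rewrite [_ == ord_max]eq_sym (negPf (neq_lift _ _)) !(mulr1, mul1r);
  by rewrite (mulrN1, mulN1r) (addNr, addrN).
Qed.

Lemma row_boost_max b F :
  row ord_max (boost b *m F) = \sum_i b 0 i *: row (lift ord_max i) F.
Proof.
rewrite row_mul mulmx_sum_row (bigD1_ord ord_max)//= !mxE unlift_none.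
rewrite scale0r add0r.
by apply: eq_bigr => i _; rewrite !mxE unlift_none liftK.
Qed.

Lemma row_boost_lift b F i :
  row (lift ord_max i) (boost b *m F) = b 0 i *: row ord_max F.
Proof.
rewrite row_mul mulmx_sum_row (bigD1_ord ord_max)//= !mxE liftK unlift_none.
by rewrite big1 ?addr0// => j _; rewrite !mxE !liftK scale0r.
Qed.

(** This packs the equations E_i' = a_i U and U' = sum_i a_i E_i into one matrix equation F' =
    boost(a) F. *)
Lemma boost_frame b E u :
  boost b *m frame E u = frame (fun i => b 0 i *: u) (\sum_i b 0 i *: E i).
Proof.
apply/row_matrixP; elim/ord_max_liftP => [|i].
  rewrite row_boost_max row_frame_max.
  by apply: eq_bigr => i _; rewrite row_frame_lift.
by rewrite row_boost_lift row_frame_max row_frame_lift.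
Qed.

Lemma is_derive_row {V : normedModType R} {m n} (M : V -> 'M[R]_(m, n)) (p h : V)
    dM al :
  is_derive p h M dM -> is_derive p h (fun q => row al (M q)) (row al dM).
Proof.
move=> /is_derive_mxP dMp; apply/is_derive_mxP => i j; rewrite mxE.
by under eq_fun do rewrite mxE.
Qed.

Lemma cvg_mink {U : topologicalType} (f g : U -> 'rV[R]_4) (p : U) :
  {for p, continuous f} -> {for p, continuous g} ->
  {for p, continuous (fun q => mink (f q) (g q))}.
Proof.
move=> cf cg; have E (v w : 'rV[R]_4) :
    mink v w = \sum_k v 0 k * eta R k k * w 0 k.
  by rewrite /mink mul_mx_diag mxE; apply: eq_bigr => k _; rewrite !mxE eqxx.
rewrite /prop_for /continuous_at E; under eq_fun do rewrite E.
apply: cvg_big => [|k _]; first exact: add_continuous.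
apply: cvgM; last first.
  exact: (continuous_comp cg (@coord_continuous _ _ _ 0 k (g p))).
apply: cvgM; last exact: cvg_cst.
exact: (continuous_comp cf (@coord_continuous _ _ _ 0 k (f p))).
Qed.

End Minkowski.

(** * Globalization *)

(* P t S reads "S solves the system at time t". *)
Section Monodromy.
Context {R : realType} {W : topologicalType} {T : Type}.
Variables (D : set W) (tau : W -> R) (M : W -> T) (P : R -> (R -> T) -> Prop).
Hypothesis P_near : forall t S S',
  (\forall s \near t, S s = S' s) -> P t S -> P t S'.
Hypothesis P_unique : forall J S S' t, is_interval J ->
  (forall s, J s -> P s S) -> (forall s, J s -> P s S') -> J t -> S t = S' t ->
  forall s, J s -> S s = S' s.
Hypothesis D_open : open D.
Hypothesis D_connected : connected D.
Hypothesis M_local : forall p, D p -> exists (J : set R) (S : R -> T),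
  [/\ open J /\ is_interval J, forall t, J t -> P t S,
      forall t, J t -> exists q, [/\ D q, tau q = t & M q = S t] &
      \forall q \near p, J (tau q) /\ M q = S (tau q)].

(* q is reached from p by a solution defined on an interval of times; for fixed
   p this is an open and closed condition on q in D. *)
Let joined p q := exists (J : set R) (S : R -> T), [/\ open J /\ is_interval J,
  forall t, J t -> P t S, J (tau p) /\ J (tau q) &
  S (tau p) = M p /\ S (tau q) = M q].

Lemma is_intervalU (J K : set R) t : is_interval J -> is_interval K ->
  J t -> K t -> is_interval (J `|` K).
Proof.
move=> Ji Ki Jt Kt x y Hx Hy z /andP[xz zy].
have [zt|/ltW tz] := leP z t.
  by case: Hx => Hx; [left; apply: (Ji x t)|right; apply: (Ki x t)];
     rewrite ?xz.
by case: Hy => Hy; [left; apply: (Ji t y)|right; apply: (Ki t y)];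
   rewrite ?tz.
Qed.

(** The two intervals of times meet in an interval containing [tau q]. Uniqueness makes the
    solutions agree there, so they glue to a solution on the union. *)
Let joined_trans p q r (J : set R) (S : R -> T) :
  joined p q -> open J -> is_interval J ->
  (forall t, J t -> P t S) -> J (tau q) -> M q = S (tau q) ->
  J (tau r) -> M r = S (tau r) -> joined p r.
Proof.
move=> [J' [S' [[J'o J'i] PS' [J'p J'q] [Sp Sq]]]] Jo Ji PS Jq Mq Jr Mr.
have SS' t : J t -> J' t -> S' t = S t.
  move=> Jt J't; apply: (@P_unique (J `&` J') S' S (tau q)) => //.
  - move=> x y [Jx J'x] [Jy J'y] z xzy.
    by split; [exact: (Ji x y)|exact: (J'i x y)].
  - by move=> s [_ /PS'].
  - by move=> s [/PS].
  - by rewrite Sq.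
pose S'' t := if `[< J' t >] then S' t else S t.
have S''J' t : J' t -> S'' t = S' t by move=> J't; rewrite /S'' asboolT.
have S''J t : J t -> S'' t = S t.
  by move=> Jt; rewrite /S''; case: asboolP => // J't; exact: SS'.
exists (J' `|` J), S''; split.
- by split; [exact: openU|exact: (is_intervalU J'i Ji J'q Jq)].
- move=> t [J't|Jt].
    apply: (P_near _ (PS' _ J't)); near=> s; rewrite S''J'//.
    by near: s; exact: open_nbhs_nbhs.
  apply: (P_near _ (PS _ Jt)); near=> s; rewrite S''J//.
  by near: s; exact: open_nbhs_nbhs.
- by split; [left|right].
- by rewrite S''J'// S''J.
Unshelve. all: by end_near. Qed.

(** The same local solution around [q] leads from [q] to [r] and back. *)
Let joined_near p q : D q -> \forall r \near q, joined p q <-> joined p r.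
Proof.
move=> Dq; have [J [S [[Jo Ji] PS _ MS]]] := M_local Dq.
have [Jq Mq] := nbhs_singleton MS.
near=> r; have [Jr Mr] : J (tau r) /\ M r = S (tau r) by near: r.
by split=> jo; apply: (joined_trans jo Jo Ji PS).
Unshelve. all: by end_near. Qed.

Let joinedT p q : D p -> D q -> joined p q.
Proof.
move=> Dp Dq; have openK (C : set W) :
    (forall r, D r -> C r -> \forall r' \near r, C r') -> open (D `&` C).
  move=> C_near; rewrite openE => r [Dr Cr]; apply: filterI (C_near r Dr Cr).
  exact: open_nbhs_nbhs.
suff E : D `&` joined p = D by move: Dq; rewrite -{1}E => -[].
apply: D_connected.
- exists p; split=> //; have [J [S [Jo PS _ MS]]] := M_local Dp.
  by have [Jp Mp] := nbhs_singleton MS; exists J, S.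
- exists (D `&` joined p); last by rewrite setIA setIid.
  apply: openK => r Dr pr; have := joined_near p Dr.
  by apply: filterS => r' /iffLR; exact.
(* The points of [D] not joined to [p] form an open set; its complement is closed and meets [D]
   exactly in the points joined to [p]. *)
- exists (~` (D `&` ~` joined p)).
    apply: open_closedC; apply: openK => r Dr pr; have := joined_near p Dr.
    by apply: filterS => r' /iffRL rr' /rr'.
  by rewrite setCI setIUr setICr set0U setCK.
Qed.

(** Two points of [D] at the same time lie on a common solution, which has a single value at that
    time; hence [M] depends on the time alone. *)
Lemma factor_through_time : D !=set0 ->
  exists S : R -> T, (forall p, D p -> M p = S (tau p)) /\
    (forall t, (tau @` D) t -> P t S).
Proof.
move=> [p0 Dp0]; have MM p q : D p -> D q -> tau p = tau q -> M p = M q.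
  move=> Dp Dq pq; have [J [S [_ _ _]]] := joinedT Dp Dq.
  by rewrite pq => -[<- <-].
(* One point of [D] is chosen over each time; a time not attained in [D] receives the value at
   [p0]. *)
pose S t := M (xget p0 [set q | D q /\ tau q = t]).
have MS q : D q -> M q = S (tau q).
  move=> Dq; rewrite /S; case: xgetP => [r _ [Dr rq]|/(_ q)[]//].
  exact: MM.
exists S; split => // _ [p Dp <-].
have [J [S' [[Jo Ji] PS' SM S'p]]] := M_local Dp.
have [Jp _] := nbhs_singleton S'p.
(* Every time near [tau p] is attained at a point of [D] where [M] has the value of [S'], so the
   pointwise choice [S] coincides with [S'] near [tau p]. *)
apply: (P_near _ (PS' _ Jp)); near=> t.
have /SM[q [Dq <- <-]] : J t by near: t; exact: open_nbhs_nbhs.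
exact: MS.
Unshelve. all: by end_near. Qed.

End Monodromy.

(** * Fermi-Walker transport as a linear differential system *)

Section FermiWalkerSystem.
Context {R : realType} (a : R -> 'rV[R]_3).

(* The rows of the first component are e_(1), e_(2), e_(3), u; the second
   component is the worldline. *)
Definition FW_system (t : R) (S : R -> 'M[R]_4 * 'rV[R]_4) : Prop :=
  [/\ is_derive t 1 (fun s => (S s).1) (boost (a t) *m (S t).1),
      is_derive t 1 (fun s => (S s).2) (row ord_max (S t).1) &
      orthonormal_frame (S t).1].

Lemma FW_system_near t S S' :
  (\forall s \near t, S s = S' s) -> FW_system t S -> FW_system t S'.
Proof.
move=> SS' [dS1 dS2 oS]; have St := nbhs_singleton SS'; rewrite /FW_system -St.
by split=> //; [apply: near_eq_is_derive dS1|apply: near_eq_is_derive dS2];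
  apply: filterS SS' => s ->.
Qed.

(** For the two frames F and F', the matrix F^T eta F' is constant and equals [eta] at time [t];
    orthonormality of F turns this into F = F'. The two worldlines then have equal derivatives. *)
Lemma FW_system_unique (J : set R) S S' t : is_interval J ->
  (forall s, J s -> FW_system s S) -> (forall s, J s -> FW_system s S') ->
  J t -> S t = S' t -> forall s, J s -> S s = S' s.
Proof.
move=> Ji PS PS' Jt SS't.
have S1 s : J s -> (S s).1 = (S' s).1.
  move=> Js; have [_ _ oS] := PS s Js.
  (* S^T eta S' is conserved, since boosts preserve eta. *)
  have dG r : J r ->
      is_derive r 1 (fun r => (S r).1^T *m eta R *m (S' r).1) 0.
    move=> /[dup] /PS[dSr _ _] /PS'[dS'r _ _].
    have deta : is_derive r 1 (cst (eta R)) 0 by exact: is_derive_cst.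
    have := is_derive_mulmx (is_derive_mulmx (is_derive_trmx dSr) deta) dS'r.
    rewrite mulmx0 addr0 trmx_mul => /is_derive_eq; apply.
    rewrite -!mulmxA -mulmxDr [(boost _)^T *m _]mulmxA [eta R *m _]mulmxA.
    by rewrite -mulmxDl boost_eta mul0mx mulmx0.
  have := is_derive0_eq Ji dG Js Jt.
  have [_ _ /orthonormal_frame_tr oSt] := PS t Jt.
  rewrite -SS't oSt => oSS'.
  have -> : (S' s).1 = (S s).1 *m eta R *m ((S s).1^T *m eta R *m (S' s).1).
    by rewrite !mulmxA oS eta_mul mul1mx.
  by rewrite oSS' -mulmxA eta_mul mulmx1.
move=> s Js; suff S2 : (S s).2 = (S' s).2.
  by rewrite [LHS]surjective_pairing [RHS]surjective_pairing S1// S2.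
have dz r : J r -> is_derive r 1 (fun r => (S r).2 - (S' r).2) 0.
  move=> Jr; have [[_ dSr _] [_ dS'r _]] := (PS r Jr, PS' r Jr).
  by have := is_deriveB dSr dS'r; rewrite S1// subrr.
have := is_derive0_eq Ji dz Js Jt.
by rewrite SS't subrr => /subr0_eq.
Qed.

End FermiWalkerSystem.

(** * Symmetry of second derivatives of vector-valued C^2 maps *)

Lemma near_eq_continuous {U W : topologicalType} (f g : U -> W) (p : U) :
  (\forall q \near p, f q = g q) -> {for p, continuous f} ->
  {for p, continuous g}.
Proof.
move=> fg cf; rewrite /prop_for /continuous_at -(nbhs_singleton fg).
by apply: cvg_trans cf; apply: near_eq_cvg; apply: filterS fg => q ->.
Qed.

Section SecondDerivatives.
Context {R : realType} {V : normedModType R} {n : nat}.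

Lemma derive_coord (f : V -> 'rV[R]_n) p v i :
  derivable f p v -> 'D_v (fun q => f q 0 i) p = 'D_v f p 0 i.
Proof. by move=> fp; rewrite derive_mx// mxE. Qed.

(** The real case is applied to each coordinate. Identities between derivatives are known on [D]
    only; as [D] is open they hold near each of its points and can be differentiated again. *)
Lemma Ck2_derive_commute (D : set V) (f : V -> 'rV[R]_n) p u v :
  open D -> Ck 2 D f -> D p -> 'D_u ('D_v f) p = 'D_v ('D_u f) p.
Proof.
move=> Do [f1 f2] Dp; apply/rowP => i.
have df q w : D q -> derivable f q w by move=> /f1; exact: diff_derivable.
have ddf q w w' : D q -> derivable ('D_w f) q w'.
  by move=> Dq; apply: diff_derivable; exact: (f2 w).1.
pose g q := f q 0 i.
have near_D q : D q -> \forall r \near q, D r by move=> ?; exact: open_nbhs_nbhs.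
have dg w q : D q -> 'D_w f q 0 i = 'D_w g q.
  by move=> Dq; rewrite derive_coord//; exact: df.
have dg_near w q : D q -> \forall r \near q, 'D_w f r 0 i = 'D_w g r.
  by move=> /near_D; apply: filterS => r; exact: dg.
have ddg w w' q : D q -> 'D_w' ('D_w f) q 0 i = 'D_w' ('D_w g) q.
  move=> Dq; rewrite -derive_coord; last exact: ddf.
  exact: near_eq_derive (dg_near w q Dq).
have cg w w' : {for p, continuous ('D_w' ('D_w g))}.
  apply: (@near_eq_continuous _ _ (fun q => 'D_w' ('D_w f) q 0 i)).
    by apply: filterS (near_D _ Dp) => q; exact: ddg.
  apply: (@continuous_comp _ _ _ ('D_w' ('D_w f)) (fun x : 'rV[R]_n => x 0 i)).
    exact: ((f2 w).2 w' p Dp).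
  exact: coord_continuous.
have gd q : D q -> derivable g q u /\ derivable g q v.
  by move=> Dq; split; exact: (derivable_mxP f q _).1 (df q _ Dq) 0 i.
have ddgq w w' q : D q -> derivable ('D_w g) q w'.
  move=> Dq; apply: near_eq_derivable (dg_near w q Dq) _.
  exact: (derivable_mxP _ q _).1 (ddf q w w' Dq) 0 i.
have gdd q : D q -> derivable ('D_u g) q v /\ derivable ('D_v g) q u.
  by move=> Dq; split; exact: ddgq.
apply: etrans (ddg v u p Dp) _; apply: etrans _ (esym (ddg u v p Dp)).
exact: derive_commute Do Dp gd gdd (cg v u) (cg u v).
Qed.

End SecondDerivatives.

(** * The spatial product, polarization and auxiliary derivatives *)

Section SpatialProduct.
Context {R : realType}.
Implicit Types x y : 'rV[R]_3.

Lemma dot3C x y : dot3 x y = dot3 y x.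
Proof. by apply: eq_bigr => i _; rewrite mulrC. Qed.

Lemma dot3Dl x x' y : dot3 (x + x') y = dot3 x y + dot3 x' y.
Proof.
by rewrite /dot3 -big_split; apply: eq_bigr => i _; rewrite mxE mulrDl.
Qed.

Lemma dot3Dr x y y' : dot3 x (y + y') = dot3 x y + dot3 x y'.
Proof. by rewrite dot3C dot3Dl !(dot3C x). Qed.

Lemma dot3Zl k x y : dot3 (k *: x) y = k * dot3 x y.
Proof.
by rewrite /dot3 mulr_sumr; apply: eq_bigr => i _; rewrite mxE mulrA.
Qed.

Lemma dot30l y : dot3 0 y = 0.
Proof. by rewrite -(scale0r 0) dot3Zl mul0r. Qed.

Lemma dot3_deltal i y : dot3 (delta_mx 0 i) y = y 0 i.
Proof.
rewrite /dot3 (bigD1 i)//= big1 ?addr0 ?mxE ?eqxx ?mul1r// => j ji.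
by rewrite mxE (negPf ji) andbF mul0r.
Qed.

End SpatialProduct.

Lemma mink_polarization {R : realType} (v w : 'rV[R]_4) A B C :
  mink v v = A -> mink w w = B -> mink (v + w) (v + w) = C ->
  mink v w = (C - A - B) / 2.
Proof. by move=> <- <- <-; rewrite minkDl !minkDr [mink w v]minkC; field. Qed.

(* Symmetry in the first two slots and skewness in the last two force a
   Christoffel symbol of a metric with constant coefficients to vanish. *)
Lemma sym_skew_eq0 {R : realType} {T : Type} (H : T -> T -> T -> R)
    (c : T -> T -> Prop) u v w :
  (forall u v w, H u v w = H v u w) ->
  (forall u v w, c v w -> H u v w = - H u w v) ->
  c u v -> c v w -> c w u -> H u v w = 0.
Proof.
move=> Hsym Hskew cuv cvw cwu; have : H u v w = - H u v w.
  rewrite {1}(Hskew u v w)// (Hsym u w v) (Hskew w u v)// opprK.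
  by rewrite (Hsym w v u) (Hskew v w u)// (Hsym v u w).
by move/eqP; rewrite -addr_eq0 -mulr2n mulrn_eq0/= => /eqP.
Qed.

(** Only the restriction to one line matters, so this applies to the lapse in spatial directions
    although [a] is an arbitrary function of time. *)
Lemma is_derive_affine {R : realType} {V : normedModType R} (f : V -> R)
    (p v : V) (l : R) :
  (forall h : R, f (h *: v + p) = h * l + f p) -> is_derive p v f l.
Proof.
move=> fE; have : is_derive (0 : R) 1 (fun h : R => f (h *: v + p)) l.
  rewrite (_ : (fun h => _) = l \*: id + cst (f p)); last first.
    by apply/funext => h; rewrite fE mulrC.
  by apply: is_derive_eq; rewrite addr0 [l *: _]mulr1.
by move=> /(is_derive_lineP f p v 0); rewrite scale0r add0r.
Qed.

Lemma is_derive_frame {R : realType} {V : normedModType R}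
    (E : 'I_3 -> V -> 'rV[R]_4) (u : V -> 'rV[R]_4) (p v : V) dE du :
  (forall i, is_derive p v (E i) (dE i)) -> is_derive p v u du ->
  is_derive p v (fun q => frame (E ^~ q) (u q)) (frame dE du).
Proof.
move=> dEp dup; apply/is_derive_mxP => al m; rewrite !mxE.
under eq_fun do rewrite !mxE.
elim/ord_max_liftP: al => [|i]; rewrite ?liftK ?unlift_none.
  exact: (is_derive_mxP _ _ _ _).1 dup 0 m.
exact: (is_derive_mxP _ _ _ _).1 (dEp i) 0 m.
Qed.

(** * The moving frame *)

Local Notation point R := ('rV[R]_3 * R^o)%type.
Definition space_dir {R : realType} (x : 'rV[R]_3) : point R := (x, 0).
Definition time_dir {R : realType} : point R := (0, 1).

Lemma space_dir_sum {R : realType} (x : 'rV[R]_3) :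
  space_dir x = \sum_i x 0 i *: space_dir (delta_mx 0 i).
Proof.
rewrite {1}[x]row_sum_delta.
apply: (big_ind2 (fun y (s : point R) => space_dir y = s)) => //.
  move=> y s y' s' <- <-.
  by rewrite -[RHS]/(y + y', (0 + 0 : R^o)) addr0.
move=> i _; rewrite -[RHS]/(x 0 i *: delta_mx 0 i, (x 0 i * 0 : R^o)).
by rewrite mulr0.
Qed.

Local Opaque mink.

(* T v and TT w v stand for the derivatives D_v X and D_w D_v X; keeping them
   abstract prevents the unfolding of limits during unification. *)
Lemma is_derive_time {R : realType} {W : normedModType R} (F : point R -> W) x t l :
  is_derive (x, t) time_dir F l -> is_derive t 1 (fun s : R => F (x, s)) l.
Proof.
have E (s : R) : s *: time_dir + (x, 0) = (x, s) :> point R.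
  rewrite -[LHS]/(s *: 0 + x, (s * 1 + 0 : R^o)).
  by rewrite scaler0 add0r addr0 mulr1.
rewrite -[in X in X -> _]E => /(is_derive_lineP F (x, 0) time_dir t).
by under eq_fun do rewrite E.
Qed.

Lemma near_open_R {R : realType} (I : set R^o) t : open I -> I t ->
  \forall s \near t, I s.
Proof. by move=> Io It; exact: open_nbhs_nbhs. Qed.

(** On the real line the derivative in direction [v] is [v] times the ordinary derivative, which
    reduces [Ck] to ordinary derivatives. *)
Lemma Ck2_curve {R : realType} (I : set R^o) (z u w : R^o -> 'rV[R]_4) :
  open I -> (forall t, I t -> is_derive t 1 z (u t)) ->
  (forall t, I t -> is_derive t 1 u (w t)) ->
  (forall t, I t -> {for t, continuous w}) -> Ck 2 I z.
Proof.
move=> Io dz du cw.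
have scaled (f df : R^o -> 'rV[R]_4) (v t : R^o) : is_derive t 1 f (df t) ->
    'D_v f t = v *: df t.
  move=> [/derivable1_diffP fd <-]; rewrite !deriveE//.
  by rewrite -linearZ/=; congr ('d f t _); rewrite [v *: 1]mulr1.
have near_scaled (f df : R^o -> 'rV[R]_4) (v t : R^o) : I t ->
    (forall t, I t -> is_derive t 1 f (df t)) ->
    \forall s \near t, v *: df s = 'D_v f s.
  move=> It dfI; apply: filterS (near_open_R Io It) => s Is.
  exact: esym (scaled f df v s (dfI s Is)).
have du' v t : I t -> is_derive t 1 ('D_v z) (v *: w t).
  move=> It; apply: near_eq_is_derive (near_scaled z u v t It dz) _.
  exact: is_deriveZ (du t It).
split=> [t It|v].
  by apply/derivable1_diffP; have [] := dz t It.
split=> [t It|v' t It].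
  by apply/derivable1_diffP; have [] := du' v t It.
apply: (near_eq_continuous (near_scaled _ (fun t => v *: w t) v' t It (du' v))).
have cwt := cw t It.
exact: cvgZ (cvg_cst _) (cvgZ (cvg_cst _) cwt).
Qed.

Section FermiWalkerFrame.
Context {R : realType} {D : set (point R)}.
Context {X : point R -> 'rV[R]_4} {a : R -> 'rV[R]_3}.
Context {T : point R -> point R -> 'rV[R]_4}.
Context {TT : point R -> point R -> point R -> 'rV[R]_4}.
Implicit Types (p q v w : point R) (x y : 'rV[R]_3).

Definition lapse p : R := 1 + dot3 p.1 (a p.2).
Definition space_frame (i : 'I_3) p : 'rV[R]_4 := T (space_dir (delta_mx 0 i)) p.
Definition unit_normal p : 'rV[R]_4 := (lapse p)^-1 *: T time_dir p.
(** The point at xi = 0 of the slice through [p], extrapolated affinely because [(0, p.2)] may lie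
    outside [D]. *)
Definition origin p : 'rV[R]_4 := X p - \sum_i p.1 0 i *: space_frame i p.

Hypothesis D_open : open D.
Hypothesis lapse_gt0 : forall p, D p -> 0 < lapse p.
Hypothesis is_derive_X : forall p v, D p -> is_derive p v X (T v p).
Hypothesis is_derive_T : forall p v w, D p -> is_derive p w (T v) (TT w v p).
Hypothesis TT_sym : forall p v w, D p -> TT w v p = TT v w p.
Hypothesis T_space : forall p x, D p ->
  T (space_dir x) p = \sum_i x 0 i *: space_frame i p.
Hypothesis mink_T : forall p v w, D p ->
  mink (T v p) (T w p) = dot3 v.1 w.1 - lapse p ^+ 2 * (v.2 * w.2).

Lemma near_D p : D p -> \forall q \near p, D q.
Proof. by move=> ?; exact: open_nbhs_nbhs. Qed.

Lemma derive_mink_T p u v w : D p ->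
  is_derive p u (fun q => mink (T v q) (T w q))
    (mink (TT u v p) (T w p) + mink (T v p) (TT u w p)).
Proof. by move=> Dp; apply: is_derive_mink; exact: is_derive_T. Qed.

Lemma derive_const_on (f : point R -> R) p u df c : D p ->
  is_derive p u f df -> (forall q, D q -> f q = c) -> df = 0.
Proof.
move=> Dp [_ <-] fc; rewrite -[RHS](derive_cst c p u); apply: near_eq_derive.
exact: filterS (near_D Dp).
Qed.

(** The condition removes the lapse term, so the product of [T v] and [T w] is constant on [D], and
    differentiating it gives the skewness. *)
Lemma mink_TT_skew p u v w : D p -> v.2 * w.2 = 0 ->
  mink (TT u v p) (T w p) = - mink (TT u w p) (T v p).
Proof.
move=> Dp vw0; apply/eqP; rewrite -addr_eq0 [X in _ + X]minkC; apply/eqP.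
apply: (derive_const_on Dp (derive_mink_T u v w Dp)) => q Dq.
by rewrite mink_T// vw0 mulr0 subr0.
Qed.

(** The three conditions say that at most one of the directions has a time component; such
    Christoffel symbols involve only constant coefficients of the metric. *)
Lemma mink_TT_eq0 p u v w : D p ->
  u.2 * v.2 = 0 -> v.2 * w.2 = 0 -> w.2 * u.2 = 0 ->
  mink (TT u v p) (T w p) = 0.
Proof.
move=> Dp; apply: (@sym_skew_eq0 _ _ (fun u v w => mink (TT u v p) (T w p))
  (fun v w => v.2 * w.2 = 0)).
  by move=> u' v' w'; rewrite TT_sym.
by move=> u' v' w'; exact: mink_TT_skew.
Qed.

Lemma lapse_neq0 p : D p -> lapse p != 0.
Proof. by move=> /lapse_gt0; exact: lt0r_neq0. Qed.

Lemma is_derive_lapse_space p x :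
  is_derive p (space_dir x) lapse (dot3 x (a p.2)).
Proof.
apply: is_derive_affine => h; rewrite /lapse/= scaler0 add0r dot3Dl dot3Zl.
by rewrite addrCA.
Qed.

Lemma mink_T_time p : D p -> mink (T time_dir p) (T time_dir p) = - lapse p ^+ 2.
Proof. by move=> Dp; rewrite mink_T//= dot30l mulr1 mulr1 sub0r. Qed.

Lemma derivable_lapse p v : D p -> derivable lapse p v.
Proof.
move=> Dp; pose Q q := - mink (T time_dir q) (T time_dir q).
have QE q : D q -> Q q = lapse q ^+ 2.
  by move=> Dq; rewrite /Q mink_T_time// opprK.
(* a is not assumed regular: lapse inherits its regularity from X. *)
apply: (@near_eq_derivable _ _ _ (fun q => Num.sqrt (Q q))).
  apply: filterS (near_D Dp) => q Dq.
  by rewrite QE// sqrtr_sqr gtr0_norm//; exact: lapse_gt0.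
have dQ := is_deriveN (derive_mink_T v time_dir time_dir Dp).
have Qp : 0 < Q p by rewrite QE// exprn_gt0//; exact: lapse_gt0.
by have [] := is_derive_comp1 dQ (is_derive1_sqrt Qp).
Qed.

(** This Christoffel symbol has two time indices. It comes from differentiating <D_tau X, D_tau X> =
    - N^2 in a spatial direction, along which N is affine. *)
Lemma mink_TT_time p x : D p ->
  mink (TT (space_dir x) time_dir p) (T time_dir p) = - (lapse p * dot3 x (a p.2)).
Proof.
move=> Dp; have dN := is_derive_lapse_space p x.
have dT := derive_mink_T (space_dir x) time_dir time_dir Dp.
have dNN := is_derive_mul dN dN.
have d0 := is_deriveD dT dNN.
have : mink (TT (space_dir x) time_dir p) (T time_dir p) +
    mink (T time_dir p) (TT (space_dir x) time_dir p) +
    (dot3 x (a p.2) * lapse p + lapse p * dot3 x (a p.2)) = 0.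
  apply: (derive_const_on (c := 0) Dp d0) => q Dq.
  rewrite -[LHS]/(mink (T time_dir q) (T time_dir q) + lapse q * lapse q).
  by rewrite mink_T_time// expr2 addNr.
rewrite [mink (T _ _) _]minkC.
by move: (mink _ _) (lapse p) (dot3 _ _) => m n d; lra.
Qed.

Lemma mink_space_frame p i j : D p ->
  mink (space_frame i p) (space_frame j p) = (i == j)%:R.
Proof.
by move=> Dp; rewrite mink_T//= mulr0 mulr0 subr0 dot3_deltal mxE eqxx.
Qed.

Lemma mink_space_time p x : D p -> mink (T (space_dir x) p) (T time_dir p) = 0.
Proof. by move=> Dp; rewrite mink_T//= mul0r mulr0 subr0 dot3C dot30l. Qed.

Lemma mink_space_normal p i : D p -> mink (space_frame i p) (unit_normal p) = 0.
Proof. by move=> Dp; rewrite minkZr mink_space_time// mulr0. Qed.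

Lemma mink_normal p : D p -> mink (unit_normal p) (unit_normal p) = -1.
Proof.
move=> Dp; rewrite minkZr minkZl mink_T_time// expr2.
by have := lapse_neq0 Dp => ?; field.
Qed.

Lemma orthonormal_space_frame p : D p ->
  orthonormal_frame (frame (space_frame ^~ p) (unit_normal p)).
Proof.
move=> Dp; apply: orthonormal_frameP => [i j|i|].
- exact: mink_space_frame.
- exact: mink_space_normal.
- exact: mink_normal.
Qed.

Lemma space_frame_eq p (v w : 'rV[R]_4) : D p ->
  (forall i, mink v (space_frame i p) = mink w (space_frame i p)) ->
  mink v (unit_normal p) = mink w (unit_normal p) -> v = w.
Proof.
move=> Dp vwE vwu; apply: (mink_frame_eq (orthonormal_space_frame Dp)).
elim/ord_max_liftP => [|i]; first by rewrite row_frame_max.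
by rewrite row_frame_lift.
Qed.

Lemma TT_space p x i : D p -> TT (space_dir x) (space_dir (delta_mx 0 i)) p = 0.
Proof.
move=> Dp; apply: (space_frame_eq Dp) => [j|]; rewrite mink0l.
  by rewrite mink_TT_eq0//= mul0r.
by rewrite minkZr mink_TT_eq0//= ?(mul0r, mulr0)// mulr0.
Qed.

(** Once the two derivatives are exchanged, [mink_TT_time] gives the product with U as - a_i = a_i
    <U, U>; the products with the E_j carry a single time index and vanish. *)
Lemma TT_time_space p i : D p ->
  TT time_dir (space_dir (delta_mx 0 i)) p = a p.2 0 i *: unit_normal p.
Proof.
move=> Dp; rewrite TT_sym//; apply: (space_frame_eq Dp) => [j|].
  rewrite minkZl [mink (unit_normal p) _]minkC mink_space_normal// mulr0.
  by rewrite mink_TT_eq0//= ?(mul0r, mulr0).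
rewrite minkZl mink_normal// minkZr mink_TT_time// dot3_deltal.
by have := lapse_neq0 Dp => ?; field.
Qed.

Lemma derivable_unit_normal p v : D p -> derivable unit_normal p v.
Proof.
move=> Dp; have dN : derivable (fun q => (lapse q)^-1) p v.
  by apply: derivableV; [exact: lapse_neq0|exact: derivable_lapse].
by have [] := is_derive_scale (derivableP dN) (is_derive_T time_dir v Dp).
Qed.

(** Differentiating <U, E_i> = 0 and <U, U> = -1 determines all products of the derivative of U with
    the frame, without computing D_tau D_tau X or the time derivative of the lapse. *)
Lemma is_derive_unit_normal p v du : D p ->
  mink du (unit_normal p) = 0 ->
  (forall i, mink du (space_frame i p) =
     - mink (unit_normal p) (TT v (space_dir (delta_mx 0 i)) p)) ->
  is_derive p v unit_normal du.
Proof.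
move=> Dp duu duE.
have dU : is_derive p v unit_normal ('D_v unit_normal p).
  by apply: derivableP; exact: derivable_unit_normal.
apply: (is_derive_eq dU); apply: (space_frame_eq Dp) => [i|].
  rewrite duE; apply/eqP; rewrite -addr_eq0; apply/eqP.
  apply: (derive_const_on Dp (is_derive_mink dU (is_derive_T _ v Dp))) => q Dq.
  by rewrite minkC; exact: mink_space_normal.
rewrite duu; have := derive_const_on Dp (is_derive_mink dU dU) mink_normal.
by rewrite [X in _ + X]minkC => /eqP; rewrite -mulr2n mulrn_eq0/= => /eqP.
Qed.

Lemma is_derive_unit_normal_space p x : D p ->
  is_derive p (space_dir x) unit_normal 0.
Proof.
move=> Dp; apply: is_derive_unit_normal => // [|i]; rewrite mink0l//.
by rewrite TT_space// minkC mink0l oppr0.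
Qed.

Lemma is_derive_unit_normal_time p : D p ->
  is_derive p time_dir unit_normal (\sum_i a p.2 0 i *: space_frame i p).
Proof.
move=> Dp; apply: is_derive_unit_normal => // [|i]; rewrite mink_suml.
  by rewrite big1// => i _; rewrite minkZl mink_space_normal// mulr0.
rewrite TT_time_space// minkZr mink_normal// mulrN1 opprK (bigD1 i)//= big1.
  by rewrite addr0 minkZl mink_space_frame// eqxx mulr1.
by move=> j ji; rewrite minkZl mink_space_frame// (negPf ji) mulr0.
Qed.

Lemma is_derive_origin p v : D p ->
  is_derive p v origin (T v p - \sum_i (v.1 0 i *: space_frame i p +
    p.1 0 i *: TT v (space_dir (delta_mx 0 i)) p)).
Proof.
move=> Dp; apply: is_deriveB; first exact: is_derive_X.
have -> : (fun q => \sum_i q.1 0 i *: space_frame i q) =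
    \sum_i (fun q => q.1 0 i *: space_frame i q).
  by apply/funext => q; rewrite fct_sumE.
apply: is_derive_sum => i; apply: is_derive_scale; last exact: is_derive_T.
by apply: is_derive_affine => h; rewrite /= !mxE.
Qed.

Lemma is_derive_origin_space p x : D p -> is_derive p (space_dir x) origin 0.
Proof.
move=> Dp; apply: (is_derive_eq (is_derive_origin (space_dir x) Dp)).
rewrite T_space// -sumrB big1// => i _.
by rewrite TT_space// scaler0 addr0 subrr.
Qed.

(** Since D_tau X = N U and D_tau E_i = a_i U, the derivative is (N - xi . a) U, and N - xi . a =
    1. *)
Lemma is_derive_origin_time p : D p ->
  is_derive p time_dir origin (unit_normal p).
Proof.
move=> Dp; apply: (is_derive_eq (is_derive_origin time_dir Dp)).
have -> : T time_dir p = lapse p *: unit_normal p.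
  by rewrite scalerA divff ?lapse_neq0// scale1r.
under eq_bigr do rewrite mxE scale0r add0r TT_time_space// scalerA.
by rewrite -scaler_suml -scalerBl addrK scale1r.
Qed.

Definition moving_frame p : 'M[R]_4 * 'rV[R]_4 :=
  (frame (space_frame ^~ p) (unit_normal p), origin p).

Lemma moving_frame_space p x : D p ->
  is_derive p (space_dir x) (fun q => (moving_frame q).1) 0 /\
  is_derive p (space_dir x) (fun q => (moving_frame q).2) 0.
Proof.
move=> Dp; split; last exact: is_derive_origin_space.
have -> : (0 : 'M[R]_4) = frame (fun=> 0) 0.
  by apply/matrixP => i j; rewrite !mxE; case: unlift => [?|]; rewrite mxE.
apply: is_derive_frame; last exact: is_derive_unit_normal_space.
by move=> i; rewrite -(TT_space x i Dp); exact: is_derive_T.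
Qed.

Lemma moving_frame_time p : D p ->
  [/\ is_derive p time_dir (fun q => (moving_frame q).1)
        (boost (a p.2) *m (moving_frame p).1),
      is_derive p time_dir (fun q => (moving_frame q).2)
        (row ord_max (moving_frame p).1) &
      orthonormal_frame (moving_frame p).1].
Proof.
move=> Dp; split; last exact: orthonormal_space_frame.
- rewrite boost_frame; apply: is_derive_frame.
    by move=> i; rewrite -(TT_time_space i Dp); exact: is_derive_T.
  exact: is_derive_unit_normal_time.
- by rewrite row_frame_max; exact: is_derive_origin_time.
Qed.

(** A ball for the product norm is a product of balls: its times form an open interval, and its
    slices at constant time are convex, so the moving frame is constant on each slice. *)
Lemma moving_frame_local p : D p ->
  exists (J : set R) (S : R -> 'M[R]_4 * 'rV[R]_4),
  [/\ open J /\ is_interval J, forall t, J t -> FW_system a t S,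
      forall t, J t -> exists q, [/\ D q, q.2 = t & moving_frame q = S t] &
      \forall q \near p, J q.2 /\ moving_frame q = S q.2].
Proof.
move=> Dp; have /nbhs_ballP[e /= e0 eD] := near_D Dp.
have JD x (t : R) : `|p.1 - x| < e -> `|p.2 - t| < e -> D (x, t).
  by move=> px pt; apply: eD; split; rewrite /= -ball_normE.
have pp : `|p.1 - p.1| < e by rewrite subrr normr0.
pose J : set R := [set t | `|p.2 - t| < e].
exists J, (fun t => moving_frame (p.1, t)); split.
- have -> : J = `](p.2 - e), (p.2 + e)[%classic.
    by apply/seteqP; split=> t; rewrite /J/= in_itv/= ltr_distlC.
  split; first exact: interval_open.
  exact: interval_is_interval.
- move=> t Jt; have [d1 d2 oM] := moving_frame_time (JD _ _ pp Jt).
  by split=> //; exact: is_derive_time.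
- by move=> t Jt; exists (p.1, t); split=> //; exact: JD.
apply/nbhs_ballP; exists e => // -[x t] [/=]; rewrite -!ball_normE/= => px Jt.
(* This segment at constant time joins [(p.1, t)] to [(x, t)] inside [D], and the moving frame has
   zero derivative along it. *)
split=> //; pose line (h : R) : point R := h *: space_dir (x - p.1) + (p.1, t).
have line0 : line 0 = (p.1, t) by rewrite /line scale0r add0r.
have line1 : line 1 = (x, t).
  by rewrite /line scale1r -[LHS]/(x - p.1 + p.1, (0 + t : R^o)) subrK add0r.
have lineD (h : R) : `[0, 1]%classic h -> D (line h).
  rewrite /= in_itv/= => /andP[h0 h1]; apply: JD.
    rewrite /= opprD addrCA subrr addr0 normrN normrZ ger0_norm//.
    by rewrite (le_lt_trans _ px)// [leRHS]distrC ler_piMl.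
  by rewrite /= scaler0 add0r.
have dline (h : R) : `[0, 1]%classic h ->
    is_derive h 1 (fun h : R => (moving_frame (line h)).1) 0 /\
    is_derive h 1 (fun h : R => (moving_frame (line h)).2) 0.
  move=> /lineD /moving_frame_space -/(_ (x - p.1))[d1 d2].
  split.
    exact: (is_derive_lineP (fun q => (moving_frame q).1) _ _ _).1 d1.
  exact: (is_derive_lineP (fun q => (moving_frame q).2) _ _ _).1 d2.
have I01 : is_interval (`[0, 1]%classic : set R) by exact: interval_is_interval.
have i0 : (`[0, 1]%classic : set R) 0 by rewrite /= in_itv/= lexx ler01.
have i1 : (`[0, 1]%classic : set R) 1 by rewrite /= in_itv/= lexx ler01.
have E1 := is_derive0_eq I01 (fun h Ih => (dline h Ih).1) i1 i0.
have E2 := is_derive0_eq I01 (fun h Ih => (dline h Ih).2) i1 i0.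
rewrite /= line0 line1 in E1 E2.
exact: (f_equal2 pair E1 E2).
Qed.

(** * The origin worldline and its tetrad *)

Hypothesis D_connected : connected D.
Hypothesis D_nonempty : D !=set0.
Hypothesis TT_continuous : forall p v w, D p -> {for p, continuous (TT w v)}.

Lemma moving_frame_factor : exists S : R -> 'M[R]_4 * 'rV[R]_4,
  (forall p, D p -> moving_frame p = S p.2) /\
  (forall t, (snd @` D) t -> FW_system a t S).
Proof.
apply: (@factor_through_time _ _ _ D snd moving_frame (FW_system a)) => //.
- exact: FW_system_near.
- exact: FW_system_unique.
- exact: moving_frame_local.
Qed.

Lemma open_times : open (snd @` D : set R^o).
Proof.
rewrite openE => _ [p Dp <-].
have [J [S [[Jo _] _ SM SP]]] := moving_frame_local Dp.
have [Jp _] := nbhs_singleton SP.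
have : \forall t \near p.2, J t by exact: open_nbhs_nbhs.
by apply: filterS => t /SM[q [Dq qt _]]; exists q.
Qed.

Lemma Fermi_Walker_origin : exists z : R^o -> 'rV[R]_4,
  worldline (snd @` D) z /\ Fermi_Walker_coordinates D X z.
Proof.
have [S [MS SP]] := moving_frame_factor.
pose z (t : R^o) := (S t).2; pose e al (t : R^o) := row al (S t).1.
pose I : set R^o := snd @` D.
pose acc (t : R^o) := row ord_max (boost (a t) *m (S t).1).
have dz t : I t -> is_derive t 1 z (e ord_max t) by move=> /SP[].
have de al t : I t -> is_derive t 1 (e al) (row al (boost (a t) *m (S t).1)).
  by move=> /SP[dS _ _]; exact: is_derive_row.
have ee al be t : I t -> mink (e al t) (e be t) = eta R al be.
  by move=> /SP[_ _ oS]; rewrite mink_rows oS.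
have emax t : I t -> mink (e ord_max t) (e ord_max t) = -1.
  by move=> It; rewrite ee// !mxE !eqxx.
have elift i t : I t -> mink (e ord_max t) (e (lift ord_max i) t) = 0.
  by move=> It; rewrite ee// !mxE (negPf (neq_lift _ _)).
have vz t : I t -> velocity z t = e ord_max t.
  by move=> It; rewrite /velocity derive1E; have [_ ->] := dz t It.
(* The velocity is identified with [e ord_max] only on [I]; openness of [I] allows this identity to
   be differentiated. *)
have az t : I t -> acceleration z t = acc t.
  move=> It; rewrite /acc /acceleration derive1E; have [_ <-] := de ord_max t It.
  apply: near_eq_derive; apply: filterS (near_open_R open_times It) => s.
  exact: vz.
have accE t : acc t = \sum_i a t 0 i *: e (lift ord_max i) t.
  exact: row_boost_max.
have acc_max t : I t -> mink (acc t) (e ord_max t) = 0.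
  move=> It; rewrite accE mink_suml big1// => i _.
  by rewrite minkZl minkC elift// mulr0.
have acc_lift i t : I t -> mink (acc t) (e (lift ord_max i) t) = a t 0 i.
  move=> It; rewrite accE mink_suml (bigD1 i)//= big1 ?addr0.
    by rewrite minkZl ee// !mxE eqxx eq_sym (negPf (neq_lift _ _)) mulr1.
  move=> j ji; rewrite minkZl ee// !mxE (inj_eq lift_inj) (negPf ji).
  by rewrite mulr0n mulr0.
(* This formula recovers the continuity of [a] on [I] from that of the second derivatives of [X], as
   needed for the worldline to be of class C^2. *)
have aE x t j : D (x, t) ->
    a t 0 j = - mink (TT time_dir (space_dir (delta_mx 0 j)) (x, t)) (e ord_max t).
  move=> Dxt; have -> : e ord_max t = unit_normal (x, t).
    by rewrite /e -(MS _ Dxt) row_frame_max.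
  by rewrite TT_time_space// minkZl mink_normal// mulrN1 opprK.
have ce al t : I t -> {for t, continuous (e al)}.
  move=> It; apply: differentiable_continuous; apply/derivable1_diffP.
  by have [] := de al t It.
have cacc t : I t -> {for t, continuous acc}.
  move=> [[x t'] Dxt /= <-{t}].
  have It' : I t' by exists (x, t').
  have cx : {for t', continuous (fun s : R^o => (x, s) : point R)}.
    exact: cvg_pair (@cvg_cst _ x _ _ _) (@cvg_id _ _).
  have Dx : \forall s \near t', D (x, s) by exact: cx (near_D Dxt).
  rewrite (_ : acc = fun t => \sum_i a t 0 i *: e (lift ord_max i) t); last first.
    exact/funext.
  apply: cvg_big => [|j _]; first exact: add_continuous.
  apply: cvgZ; last exact: ce.
  apply: (near_eq_continuous (f := fun s : R^o =>
    - mink (TT time_dir (space_dir (delta_mx 0 j)) (x, s)) (e ord_max s))).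
    by apply: filterS Dx => s /aE ->.
  apply: cvgN; apply: cvg_mink; last exact: ce.
  by apply: (continuous_comp cx); exact: TT_continuous.
exists z; split.
  split=> [|t It]; last by rewrite vz// emax.
  exact: (Ck2_curve open_times dz (de ord_max) cacc).
have aceE t : I t -> acceleration_components z e t = a t.
  by move=> It; apply/rowP => i; rewrite mxE az// acc_lift.
exists e; split.
  split=> [t It al be|al t It|t It]; first exact: ee; last by rewrite vz.
  rewrite az// vz//; apply: is_derive_eq (de al t It) _.
  (* The Fermi-Walker right-hand side reduces to the acceleration for e_(4), by <a, u> = 0 and <u,
     u> = -1, and to a_i u for e_(i), by <u, e_(i)> = 0: these are the rows of the boosted frame. *)
  elim/ord_max_liftP: al => [|i].
    by rewrite acc_max// emax// scale0r sub0r scaleN1r opprK.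
  by rewrite acc_lift// elift// scale0r subr0 row_boost_lift.
move=> xi t Dxt; have It : I t by exists (xi, t).
have ME : S t = moving_frame (xi, t) by rewrite MS.
have EE i : e (lift ord_max i) t = space_frame i (xi, t).
  by rewrite /e ME row_frame_lift.
have UE : e ord_max t = unit_normal (xi, t) by rewrite /e ME row_frame_max.
have XE : X (xi, t) - z t = \sum_i xi 0 i *: space_frame i (xi, t).
  by rewrite /z ME /= /origin opprB addrC subrK.
split; first by rewrite aceE//; exact: lapse_gt0 Dxt.
  rewrite vz// XE UE mink_suml big1// => i _.
  by rewrite minkZl mink_space_normal// mulr0.
move=> i; rewrite XE EE mink_suml (bigD1 i)//= big1 ?addr0.
  by rewrite minkZl mink_space_frame// eqxx mulr1.
by move=> j ji; rewrite minkZl mink_space_frame// (negPf ji) mulr0.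
Qed.

End FermiWalkerFrame.

(** * From the coordinate system to the moving frame *)

Theorem proposition2 (R : realType) (D : set ('rV[R]_3 * R^o))
    (X : 'rV[R]_3 * R^o -> 'rV[R]_4) (a : R -> 'rV[R]_3)
    (hX : coordinate_system D X)
    (hpos : forall p, D p -> 0 < 1 + dot3 p.1 (a p.2))
    (hds : interval_form D X a) :
  exists z : R^o -> 'rV[R]_4,
    worldline (snd @` D) z /\ Fermi_Walker_coordinates D X z.
Proof.
have [Do Dc D0 [X1 X2] _ _] := hX.
have TE v p : D p -> 'D_v X p = 'd X p v by move=> /X1; exact: deriveE.
have dX p v : D p -> is_derive p v X ('D_v X p).
  by move=> Dp; apply/derivableP/diff_derivable/X1.
have ddX p v w : D p -> is_derive p w ('D_v X) ('D_w ('D_v X) p).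
  by move=> Dp; apply/derivableP/diff_derivable; exact: (X2 v).1.
have symX p v w : D p -> 'D_w ('D_v X) p = 'D_v ('D_w X) p.
  by move=> Dp; exact: Ck2_derive_commute Do (conj X1 X2) Dp.
have spaceX p x : D p -> 'D_(space_dir x) X p =
    \sum_i x 0 i *: 'D_(space_dir (delta_mx 0 i)) X p.
  move=> Dp; rewrite (TE _ _ Dp) [in LHS]space_dir_sum linear_sum.
  by apply: eq_bigr => i _; rewrite linearZ (TE _ _ Dp).
(* The interval prescribes only a quadratic form; polarization recovers the metric as a bilinear
   form. *)
have minkX p v w : D p -> mink ('D_v X p) ('D_w X p) =
    dot3 v.1 w.1 - lapse (a := a) p ^+ 2 * (v.2 * w.2).
  move=> Dp; rewrite (TE v p Dp) (TE w p Dp).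
  have Q u : mink ('d X p u) ('d X p u) =
      dot3 u.1 u.1 - lapse (a := a) p ^+ 2 * u.2 ^+ 2.
    by case: u => x t; exact: hds.
  have Qvw := Q (v + w); rewrite linearD in Qvw.
  rewrite (mink_polarization (Q v) (Q w) Qvw) /= !dot3Dl !dot3Dr.
  by rewrite [dot3 w.1 v.1]dot3C; field.
have cX p v w : D p -> {for p, continuous ('D_w ('D_v X))}.
  exact: (X2 v).2.
exact: (@Fermi_Walker_origin R D X a (fun v p => 'D_v X p)
  (fun w v p => 'D_w ('D_v X) p) Do hpos dX ddX symX spaceX minkX Dc D0 cX).
Qed.
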